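(* Let $X$ be a nonnegative random variable and let $\nu>0$. Then $$\Pr\{X>\nu\}\;\le\;\frac{E_{\nu}(X)}{\nu}\;\le\;\frac{E(X)}{\nu},$$ where $E_{\nu}(X)=E\left(X\,1_{\{X>\nu\}}\right)$ is the restricted expectation of $X$ over $\nu$.
   Context: $X$ is a real-valued random variable on a probability space, with $X\ge 0$; no density is required (the distribution may be discrete, continuous, or general). $E$ denotes expectation (the Lebesgue integral with respect to the probability measure, with values in $[0,\infty]$ for nonnegative random variables). $1_{\{X>\nu\}}$ is the indicator random variable of the event $\{X>\nu\}$, equal to $1$ when $X>\nu$ and $0$ when $X\le\nu$. For $\nu\ge 0$, the restricted expectation of $X$ over $\nu$ is $E_{\nu}(X)=E\left(X\,1_{\{X>\nu\}}\right)$; when $X$ has a density $f$ it equals $\int_{\nu}^{\infty}x f(x)\,dx$. *)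

(* Defs.v *)
From HB Require Import structures.
From mathcomp Require Import all_boot all_order all_algebra.
From mathcomp Require Import all_classical all_reals all_analysis.

Set Implicit Arguments.
Unset Strict Implicit.
Unset Printing Implicit Defensive.

Import Order.TTheory GRing.Theory Num.Theory.

Local Open Scope classical_set_scope.
Local Open Scope ring_scope.

(* [E] takes values in [\bar R], so no integrability of [X] is required. *)
Definition restricted_expectation (d : measure_display) (T : measurableType d)
    (R : realType) (P : probability T R) (nu : R) (X : T -> R) : \bar R :=
  ('E_P[X \* \1_[set w | (nu < X w)%R]])%E.

(* Main.v *)
Require Import Defs.
From HB Require Import structures.
From mathcomp Require Import all_boot all_order all_algebra.
From mathcomp Require Import all_classical all_reals all_analysis.
From mathcomp Require Import measurable_realfun.

(** Write [A] for the event that [X] exceeds [nu].  Pointwise,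
      [nu * 1_A <= X * 1_A <= X]:
    on [A] the left inequality is [nu <= X] and the right one an equality, and
    off [A] the first two terms vanish while [X] is nonnegative.  All three
    functions are nonnegative and measurable, so integrating is monotone with
    values in the extended reals, whether or not [X] is integrable.  This gives
      [nu * P A <= restricted_expectation P nu X <= 'E_P[X]]
    ([prob_gt_le_restricted_expectation], [restricted_expectation_le]), and the
    theorem follows on dividing by the positive real [nu]. *)

Set Implicit Arguments.
Unset Strict Implicit.
Unset Printing Implicit Defensive.

Import Order.TTheory GRing.Theory Num.Theory.

Local Open Scope classical_set_scope.
Local Open Scope ereal_scope.

Lemma measurable_RV_gt (d : measure_display) (T : measurableType d)
    (R : realType) (P : probability T R) (X : {RV P >-> R}) (nu : R) :
  measurable [set w | (nu < X w)%R].
Proof.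
rewrite -preimage_itvoy -[X in measurable X]setTI.
exact: measurable_funP.
Qed.

Lemma measurable_restricted_RV (d : measure_display) (T : measurableType d)
    (R : realType) (P : probability T R) (X : {RV P >-> R}) (nu : R) :
  measurable_fun setT ((X : T -> R) \* \1_[set w | (nu < X w)%R])%R.
Proof.
apply: measurable_funM => //.
by apply: measurable_indic; exact: measurable_RV_gt.
Qed.

(** The event excludes every point where [X] is below [nu], hence, as [nu] is
    nonnegative, every point where [X] is negative.  So [X * 1_A] dominates
    [nu * 1_A] for a random variable [X] of any sign. *)
Lemma prob_gt_le_restricted_expectation (d : measure_display)
    (T : measurableType d) (R : realType) (P : probability T R)
    (X : {RV P >-> R}) (nu : R) : (0 <= nu)%R ->
  nu%:E * P [set w | (nu < X w)%R] <= restricted_expectation P nu X.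
Proof.
move=> nu_ge0; have mA := measurable_RV_gt X nu.
rewrite -(expectation_indic P mA) /restricted_expectation unlock.
rewrite -ge0_integralZl_EFin//; last first.
  by apply/measurable_EFinP; exact: measurable_indic.
apply: ge0_le_integral => //=.
- by move=> w _; rewrite mule_ge0// lee_fin.
- by apply/measurable_EFinP; apply: measurable_funM => //; exact: measurable_indic.
- by apply/measurable_EFinP; exact: measurable_restricted_RV.
- move=> w _; rewrite -EFinM lee_fin indicE.
  case: (boolP (w \in _)) => [|_]; last by rewrite !mulr0.
  by rewrite inE/= !mulr1; exact: ltW.
Qed.

Lemma restricted_expectation_le (d : measure_display) (T : measurableType d)
    (R : realType) (P : probability T R) (X : {RV P >-> R}) (nu : R) :
  (forall w, 0 <= X w)%R -> restricted_expectation P nu X <= 'E_P[X].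
Proof.
move=> X_ge0; apply: expectation_le => //.
- exact: measurable_restricted_RV.
- by move=> w /=; rewrite mulr_ge0.
- by apply: aeW => w /=; rewrite ler_piMr// indicE lern1 leq_b1.
Qed.

Theorem theorem1 (d : measure_display) (T : measurableType d) (R : realType)
    (P : probability T R) (X : {RV P >-> R}) (nu : R)
    (X_ge0 : forall w : T, (0 <= X w)%R) (nu_gt0 : (0 < nu)%R) :
  P [set w | (nu < X w)%R] <= restricted_expectation P nu X / nu%:E /\
  restricted_expectation P nu X / nu%:E <= 'E_P[X] / nu%:E.
Proof.
(* As [nu] is nonzero, the extended-real inverse is that of the reals. *)
rewrite inver gt_eqF//; split.
- rewrite lee_pdivlMr// muleC.
  exact/prob_gt_le_restricted_expectation/ltW.
- by rewrite lee_wpmul2r ?lee_fin ?invr_ge0 ?(ltW nu_gt0)// restricted_expectation_le.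
Qed.
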